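(* Let $\delta\in(0,1)$. In the contextual bandit setting with a myopic agent and a principal with full information, consider an instance of the payment scheme $\textrm{Fair-Payments}(\delta,T)$ instantiated with confidence intervals $[\ell^t_i,u^t_i]$ such that $\hat\mu^t_i=\frac{u^t_i+\ell^t_i}{2}$, and such that with probability $1-\delta$, for all $i\in[k]$, $t\in[T]$, $\mu^t_i\in[\ell^t_i,u^t_i]$. Then $\textrm{Fair-Payments}(\delta,T)$ is fair at every round, and has cost and regret $$O\left(k\sum_{t}w(t)+\delta T\right),$$ where $w(t)$ is the maximum width of any confidence interval in the top chained set $\hat X^t$ of round $t$.
   Context: Contextual bandit setting. There are $k$ arms, $T$ rounds and a context space $\mathcal X$. Each arm $j$ has an unknown function $f_j:\mathcal X\to[0,1]$. In each round $t$ an adversary reveals a context $x^t_j\in\mathcal X$ for each arm $j$; selecting arm $j$ yields a random reward in $[0,1]$ with mean $\mu^t_j=f_j(x^t_j)$. (The classic bandit setting is the case where $\mathcal X$ is a singleton, so means $\mu_j$ do not depend on $t$; the linear contextual setting is $f_j(x)=\langle\theta_j,x\rangle$.) In each round the principal offers a (possibly randomized) payment vector $p^t\in\mathbb R_+^k$. The myopic agent has empirical reward estimates $\hat\mu_i^t$ computed from its history by a method known to the principal, and selects an arm in $M=\arg\max_i(\hat\mu^t_i+p^t_i)$, ties being broken uniformly at random among the members of $M$ with maximal payment; the selected arm is paid its offered payment, and cost is the sum over rounds of the payments made. In the full information model the principal observes everything the agent observes (contexts, chosen arms, rewards), in particular the $\hat\mu_i^t$. Chaining. Given confidence intervals $[\ell_1^t,u_1^t],\dots,[\ell_k^t,u_k^t]$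 in round $t$, arms $i$ and $j$ are linked if their intervals intersect, and chained if they are in the same component of the transitive closure of the linked relation. The scheme $\textrm{Fair-Payments}(\delta,T)$. In each round $t$: let $m^t\in\arg\max_i\hat\mu_i^t$; let $\hat X^t$ be the set of arms chained to $m^t$ (the top chained set; it coincides with the set of arms chained to the arm with highest upper confidence bound); choose $j^t$ uniformly at random from $\hat X^t$; offer $p^t_{j^t}=\hat\mu^t_{m^t}-\hat\mu^t_{j^t}$ and $p^t_{i'}=0$ for all $i'\neq j^t$. Width: the width of the interval $[\ell_i^t,u_i^t]$ is $u_i^t-\ell_i^t$. Fairness. Let $\pi^t_{j|h}$ be the probability (over the principal's randomization and the agent's tie-breaking) that arm $j$ is selected in round $t$ given the history $h$. The scheme is fair in round $t$ (given $h$) if for any contexts $x^t$ and all $j,j'\in[k]$, $\pi^t_{j|h}>\pi^t_{j'|h}$ only if $f_j(x^t_j)>f_{j'}(x^t_{j'})$. ''Fair at every round'' means: with probability at least $1-\delta$ over the realization of the history, the scheme is fair in every round $t\in[T]$, for all sequences of contexts and all reward distributions. Regret. With $\pi^t$ the distribution of the selected arm $i^t$ in round $t$, regret is $\sum_t\max_jf_j(x^t_j)-\mathbb E_{i^t\sim\pi^t}\left[\sum_tf_{i^t}(x^t_{i^t})\right]$.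
   Formalization: Fairness is proved at the contexts actually revealed by any adaptive adversary; fairness simultaneously for all possible contexts in a round is proved when the confidence intervals are, with probability 1-δ, valid for all contexts. Cost and widths are in expectation. *)

(* Defs.v *)
From HB Require Import structures.
From mathcomp Require Import all_boot all_order all_algebra.
From mathcomp Require Import all_classical all_reals all_analysis.

Set Implicit Arguments.
Unset Strict Implicit.
Unset Printing Implicit Defensive.

Import Order.TTheory GRing.Theory Num.Theory.
Import numFieldNormedType.Exports.

Local Open Scope ring_scope.

Section Chaining.
Context {R : realType} {k : nat}.
Implicit Types (l u : 'I_k -> R) (m : 'I_k).

Definition linked l u : rel 'I_k := fun i j =>
  `[< ([set` `[l i, u i]] `&` [set` `[l j, u j]] !=set0)%classic >].

Definition chained l u : rel 'I_k := connect (linked l u).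

Definition chained_set l u m : {set 'I_k} := [set j | chained l u m j]%SET.

(* The default 0 is harmless: it is only used with l <= u. *)
Definition max_width l u (A : {set 'I_k}) : R :=
  \big[Num.max/0]_(i in A) (u i - l i).

End Chaining.

Section Agent.
Context {R : realType} {k : nat}.
Implicit Types (v muhat p : 'I_k -> R).

Definition argmax v : {set 'I_k} := [set i | [forall j, v j <= v i]]%SET.

Definition tie_set muhat p : {set 'I_k} :=
  let M := argmax (fun i => muhat i + p i) in
  [set i in M | [forall j in M, p j <= p i]]%SET.

Definition uniform_on (A : {set 'I_k}) (i : 'I_k) : R :=
  if i \in A then #|A|%:R^-1 else 0.

Definition offer muhat (m j : 'I_k) : 'I_k -> R :=
  fun i => if i == j then muhat m - muhat j else 0.

End Agent.

(* One context per arm; what is observed in a round is the revealed contexts,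
   the selected arm and its reward. *)
Definition profile (k : nat) (X : Type) := 'I_k -> X.
Definition obs (R : realType) (k : nat) (X : Type) :=
  (profile k X * 'I_k * R)%type.

(* The four maps take the history of past rounds, oldest first, and the contexts
   of the current round; the round number is the length of the history. *)
Record scheme (R : realType) (k : nat) (X : Type) := Scheme {
  est  : seq (obs R k X) -> profile k X -> 'I_k -> R;
  lo   : seq (obs R k X) -> profile k X -> 'I_k -> R;
  up   : seq (obs R k X) -> profile k X -> 'I_k -> R;
  lead : seq (obs R k X) -> profile k X -> 'I_k }.

Section FairPayments.
Context {R : realType} {k : nat} {X : Type}.
Implicit Types (S : scheme R k X) (h : seq (obs R k X)) (x : profile k X)
  (f : 'I_k -> X -> R).

Definition top_chain S h x : {set 'I_k} :=
  chained_set (lo S h x) (up S h x) (lead S h x).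

Definition top_width S h x : R :=
  max_width (lo S h x) (up S h x) (top_chain S h x).

Definition payment S h x (j : 'I_k) : 'I_k -> R :=
  offer (est S h x) (lead S h x) j.

(* Probability that the principal targets arm j and the agent then selects i. *)
Definition round_law S h x (j i : 'I_k) : R :=
  uniform_on (top_chain S h x) j *
  uniform_on (tie_set (est S h x) (payment S h x j)) i.

Definition sel_prob S h x (i : 'I_k) : R := \sum_j round_law S h x j i.

Definition fair_in_round f S h x : Prop := forall j j' : 'I_k,
  sel_prob S h x j' < sel_prob S h x j -> f j' (x j') < f j (x j).

Definition valid_in_round f S h x : Prop := forall i : 'I_k,
  lo S h x i <= f i (x i) <= up S h x i.

Record fair_payments S : Prop := FairPayments {
  lead_argmax : forall h x, lead S h x \in argmax (est S h x);
  lo_le_up : forall h x i, lo S h x i <= up S h x i;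
  est_midpoint : forall h x i, est S h x i = (up S h x i + lo S h x i) / 2 }.

End FairPayments.

Section Runs.
Context {R : realType} {k : nat} {dX : measure_display}
  {X : measurableType dX} {d : measure_display} {Omega : measurableType d}.
Local Open Scope classical_set_scope.

Record run := Run {
  ctx : nat -> Omega -> profile k X;
  target : nat -> Omega -> 'I_k;
  arm : nat -> Omega -> 'I_k;
  reward : nat -> Omega -> R }.

Definition hist (r : run) (t : nat) (w : Omega) : seq (obs R k X) :=
  mkseq (fun s => (ctx r s w, arm r s w, reward r s w)) t.

(* Generators of the sigma-algebra of what is known when round t's payments are
   offered: contexts up to and including round t, arms and rewards before t. *)
Definition info_gen (r : run) (t : nat) : set (set Omega) :=
  [set A | (exists s (j : 'I_k) (B : set X), [/\ (s <= t)%N, measurable B &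
              A = [set w | B (ctx r s w j)]]) \/
           (exists s (i : 'I_k), (s < t)%N /\ A = [set w | arm r s w = i]) \/
           (exists s (B : set R), [/\ (s < t)%N, measurable B &
              A = [set w | B (reward r s w)]])].

Definition info (r : run) (t : nat) : set (set Omega) := <<s info_gen r t >>.

Definition info_measurable (r : run) (t : nat) (g : Omega -> R) : Prop :=
  forall B : set R, measurable B -> info r t (g @^-1` B).

(* The adversary is adaptive and possibly randomised: ctx r t is any measurable
   process for which the conditional laws below hold.  Rewards may have any
   conditional distribution on [0, 1] with the prescribed mean. *)
Record is_run (P : probability Omega R) (T : nat) (f : 'I_k -> X -> R)
    (S : scheme R k X) (r : run) : Prop := IsRun {
  ctx_measurable : forall t j, (t < T)%N ->
    measurable_fun setT (fun w => ctx r t w j);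
  target_measurable : forall t j, (t < T)%N ->
    measurable [set w | target r t w = j];
  arm_measurable : forall t i, (t < T)%N -> measurable [set w | arm r t w = i];
  reward_measurable : forall t, (t < T)%N -> measurable_fun setT (reward r t);
  lo_measurable : forall t i, (t < T)%N ->
    info_measurable r t (fun w => lo S (hist r t w) (ctx r t w) i);
  up_measurable : forall t i, (t < T)%N ->
    info_measurable r t (fun w => up S (hist r t w) (ctx r t w) i);
  reward_bounded : forall t w, (t < T)%N -> 0 <= reward r t w <= 1;
  reward_mean : forall t i A, (t < T)%N -> info r t A ->
    (\int[P]_(w in A `&` [set w | arm r t w = i]) (reward r t w)%:E =
     \int[P]_(w in A `&` [set w | arm r t w = i]) (f i (ctx r t w i))%:E)%E;
  selection_law : forall t j i A, (t < T)%N -> info r t A ->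
    (P (A `&` [set w | target r t w = j] `&` [set w | arm r t w = i]) =
     \int[P]_(w in A)
       (round_law S (hist r t w) (ctx r t w) j i)%:E)%E }.

Definition cost (T : nat) (S : scheme R k X) (r : run) (w : Omega) : R :=
  \sum_(t < T) payment S (hist r t w) (ctx r t w) (target r t w) (arm r t w).

Definition total_width (T : nat) (S : scheme R k X) (r : run) (w : Omega) : R :=
  \sum_(t < T) top_width S (hist r t w) (ctx r t w).

(* The default 0 is harmless: it is only used with f >= 0. *)
Definition best_mean (T : nat) (f : 'I_k -> X -> R) (r : run) (w : Omega) : R :=
  \sum_(t < T) \big[Num.max/0]_(j < k) f j (ctx r t w j).

Definition earned_mean (T : nat) (f : 'I_k -> X -> R) (r : run) (w : Omega) : R :=
  \sum_(t < T) f (arm r t w) (ctx r t w (arm r t w)).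

Definition regret (P : probability Omega R) (T : nat) (f : 'I_k -> X -> R)
    (r : run) : \bar R :=
  ('E_P[best_mean T f r] - 'E_P[earned_mean T f r])%E.

Definition with_prob_at_least (P : probability Omega R) (p : R)
    (A : set Omega) : Prop :=
  exists E : set Omega, [/\ measurable E, (p%:E <= P E)%E & E `<=` A].

End Runs.

Arguments run : clear implicits.

(* Main.v *)
(* Whatever the target, the agent is uniform on the top chained set: a target
   that is not a leader becomes the unique maximizer, and a target that is one
   spreads its mass over the leaders, which are all chained together.  On the
   event that the intervals are valid, an arm outside the set has its whole
   interval, hence its mean, below those of the set, which gives fairness.
   The union of a chain of at most k overlapping intervals has length at most
   k w(t).  This bounds the payment of a round always, and its regret on the
   valid event; elsewhere the regret of a round is at most 1, which costs
   delta T in expectation. *)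

Require Import Defs.
From mathcomp Require Import all_boot all_order all_algebra.
From mathcomp Require Import all_classical all_reals all_analysis.
From mathcomp Require Import measurable_realfun lra.

Import Order.TTheory GRing.Theory Num.Theory.

Local Open Scope ring_scope.

Lemma linkedE {R : realType} {k : nat} (l u : 'I_k -> R) (i j : 'I_k) :
  (forall a, l a <= u a) -> linked l u i j = (l i <= u j) && (l j <= u i).
Proof.
move=> lu; apply/asboolP/andP => [[y []]|[ij ji]].
  rewrite /= !in_setE /= !in_itv /= => /andP[liy yui] /andP[ljy yuj].
  by rewrite (le_trans liy yuj) (le_trans ljy yui).
exists (Num.max (l i) (l j)); split; rewrite /= in_setE /= in_itv /=.
  by rewrite le_max lexx ge_max lu ji.
by rewrite le_max lexx orbT ge_max lu ij.
Qed.

Lemma linked_sym {R : realType} {k : nat} (l u : 'I_k -> R) :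
  symmetric (linked l u).
Proof. by move=> i j; rewrite /linked setIC. Qed.

Lemma chained_sym {R : realType} {k : nat} (l u : 'I_k -> R) (i j : 'I_k) :
  chained l u i j = chained l u j i.
Proof. exact: (sym_connect_sym (linked_sym l u)). Qed.

Lemma chained_set_eq {R : realType} {k : nat} (l u : 'I_k -> R) (m m' : 'I_k) :
  chained l u m m' -> chained_set l u m = chained_set l u m'.
Proof.
move=> mm'; apply/setP => j; rewrite !inE.
by apply/idP/idP; apply: connect_trans; rewrite // [connect _ _ _]chained_sym.
Qed.

Lemma le_max_width {R : realType} {k : nat} (l u : 'I_k -> R) (A : {set 'I_k}) i :
  i \in A -> u i - l i <= max_width l u A.
Proof. by move=> iA; apply: le_bigmax_cond. Qed.

Lemma max_width_ge0 {R : realType} {k : nat} (l u : 'I_k -> R) (A : {set 'I_k}) :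
  0 <= max_width l u A.
Proof. exact: bigmax_ge_id. Qed.

(* Consecutive intervals of a chain overlap, so those of a simple path cover an
   interval no longer than the sum of their at most k widths. *)
Lemma chained_spread {R : realType} {k : nat} (l u : 'I_k -> R) (m a b : 'I_k) :
  (forall i, l i <= u i) -> chained l u m a -> chained l u m b ->
  u a - l b <= k%:R * max_width l u (chained_set l u m).
Proof.
move=> lu ma mb; set W := max_width _ _ _.
have spread p c : path (linked l u) c p -> chained l u m c ->
    u c - l (last c p) <= (size p).+1%:R * W.
  elim: p c => [|c' p IHp] c /=.
    by move=> _ mc; rewrite mul1r le_max_width // inE.
  move=> /andP[cc' pc'] mc.
  have mc' : chained l u m c' := connect_trans mc (connect1 cc').
  have := IHp c' pc' mc'; have := le_max_width l u (chained_set l u m) c.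
  rewrite inE => /(_ mc); move: cc'; rewrite linkedE // => /andP[cc' _].
  rewrite -[(size p).+2]addn1 natrD mulrDl mul1r -/W; lra.
have /connectP[p ab ->] : chained l u a b.
  by apply: connect_trans mb; rewrite [connect _ _ _]chained_sym.
case/shortenP: ab => q aq uq _; apply: le_trans (spread q a aq ma) _.
rewrite ler_wpM2r ?max_width_ge0 // ler_nat.
by have := max_card (mem (a :: q)); rewrite (card_uniqP uq) card_ord.
Qed.

Lemma unchained_below {R : realType} {k : nat} (l u : 'I_k -> R) (m j i : 'I_k) :
  (forall a, l a <= u a) -> u j + l j <= u m + l m ->
  chained l u m i -> ~~ chained l u m j -> u j < l i.
Proof.
move=> lu jm mi mj; case/connectP: mi => p mp ->.
suff below q c : path (linked l u) c q -> chained l u m c -> u j < l c ->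
    u j < l (last c q).
  apply: below => //; first exact: connect0.
  have : ~~ linked l u m j by apply: contra mj; apply: connect1.
  rewrite linkedE // negb_and -!ltNge => /orP[//|]; have := lu m; have := lu j; lra.
elim: q c => //= c' q IHq c /andP[cc' qc'] mc jc.
have mc' : chained l u m c' := connect_trans mc (connect1 cc').
apply: IHq => //.
have : ~~ linked l u c' j.
  by apply: contra mj => c'j; apply: connect_trans mc' (connect1 c'j).
move: cc'; rewrite !linkedE // => /andP[cc' _].
rewrite negb_and -!ltNge => /orP[//|]; have := lu j; lra.
Qed.

Section FairPayments.
Context {R : realType} {k : nat} {X : Type} (S : scheme R k X).
Hypothesis SP : fair_payments S.
Implicit Types (h : seq (obs R k X)) (x : profile k X) (f : 'I_k -> X -> R).

Lemma argmax_chained h x (m m' : 'I_k) :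
  m \in argmax (est S h x) -> m' \in argmax (est S h x) ->
  chained (lo S h x) (up S h x) m m'.
Proof.
rewrite !inE => /forallP /(_ m') m'm /forallP /(_ m) mm'.
have lu := lo_le_up SP h x.
apply: connect1; rewrite linkedE //.
move: m'm mm'; rewrite !(est_midpoint SP).
by have := lu m; have := lu m'; move=> ? ? ? ?; apply/andP; split; lra.
Qed.

Lemma lead_chained h x m : m \in argmax (est S h x) -> m \in top_chain S h x.
Proof. by move=> mM; rewrite inE argmax_chained // (lead_argmax SP). Qed.

Lemma est_le_lead h x i : est S h x i <= est S h x (lead S h x).
Proof. by have := lead_argmax SP h x; rewrite inE => /forallP. Qed.

(* A target that is itself a leader is offered 0, like every other arm. *)
Lemma tie_set_payment h x j :
  tie_set (est S h x) (payment S h x j) =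
  if j \in argmax (est S h x) then argmax (est S h x) else [set j]%SET.
Proof.
set m := lead S h x; have em := est_le_lead h x; rewrite -/m in em.
have tot i : est S h x i + payment S h x j i =
    if i == j then est S h x m else est S h x i.
  rewrite /payment /offer -/m; case: eqP => [->|_]; last by rewrite addr0.
  by rewrite addrC subrK.
have argE i : (i \in argmax (est S h x)) = (est S h x m <= est S h x i).
  rewrite inE; apply/forallP/idP => [/(_ m)//|mi a].
  exact: le_trans (em a) mi.
have argpE i : (i \in argmax (fun i => est S h x i + payment S h x j i)) =
    (i == j) || (est S h x m <= est S h x i).
  rewrite inE; apply/forallP/idP => [/(_ j)|].
    by rewrite !tot eqxx; case: (i == j).
  move=> ij a; rewrite !tot; case: (i == j) ij => [_|/= mi].
    by case: (a == j).
  by case: (a == j) => //; apply: le_trans (em a) mi.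
apply/setP => i; rewrite inE argpE argE.
case: ifP => jM.
  have p0 a : payment S h x j a = 0.
    rewrite /payment /offer; case: eqP => // _; apply/eqP.
    by rewrite subr_eq0 eq_le jM em.
  rewrite argE; case: (eqVneq i j) => [->|_] /=; last first.
    by case: (_ <= _) => //=; apply/forall_inP => a _; rewrite !p0.
  by rewrite jM; apply/forall_inP => a _; rewrite !p0.
rewrite !inE; have pj : 0 < payment S h x j j.
  by rewrite /payment /offer eqxx subr_gt0 ltNge jM.
case: (eqVneq i j) => [->|ij] /=.
  apply/forall_inP => a _; rewrite {1}/payment /offer.
  by case: (eqVneq a j) => [_|_]; [rewrite /payment /offer eqxx|exact: ltW].
apply/negbTE; rewrite negb_and; apply/orP; right.
apply/forall_inPn; exists j; first by rewrite argpE eqxx.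
by rewrite -ltNge {1}/payment /offer (negbTE ij).
Qed.

Lemma round_law_outside h x j i :
  i \notin top_chain S h x -> round_law S h x j i = 0.
Proof.
move=> iX; rewrite /round_law {1}/uniform_on.
case: ifPn => jX; last by rewrite mul0r.
rewrite /uniform_on tie_set_payment.
case: (boolP (j \in argmax _)) => jM; case: ifPn => iM; rewrite ?mulr0 //.
  by rewrite lead_chained in iX.
by move: iM iX; rewrite inE => /eqP ->; rewrite jX.
Qed.

Lemma sel_probE h x i : sel_prob S h x i = uniform_on (top_chain S h x) i.
Proof.
set A := top_chain S h x; set M := argmax (est S h x).
have MA a : a \in M -> a \in A by exact: lead_chained.
rewrite /uniform_on -/A; case: ifPn => iA; last first.
  by apply: big1 => j _; rewrite round_law_outside.
rewrite /sel_prob /round_law -/A; case: (boolP (i \in M)) => iM.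
  rewrite (bigID (mem M)) /= [X in _ + X]big1 ?addr0 => [|j jM]; last first.
    have ij : i != j by apply: contraNneq jM => <-.
    by rewrite /uniform_on tie_set_payment -/M (negbTE jM) finset.in_set1 (negbTE ij) mulr0.
  rewrite (eq_bigr (fun=> #|A|%:R^-1 * #|M|%:R^-1)) => [|j jM].
    rewrite sumr_const -mulrnAr -[_^-1 *+ _]mulr_natl mulfV ?mulr1 //.
    by rewrite pnatr_eq0 -lt0n; apply/card_gt0P; exists i.
  by rewrite /uniform_on MA // tie_set_payment -/M jM iM.
rewrite (bigD1 i) //= big1 ?addr0 => [|j ji].
  by rewrite /uniform_on iA tie_set_payment -/M (negbTE iM) finset.in_set1 eqxx cards1
     invr1 mulr1.
rewrite /uniform_on tie_set_payment -/M eq_sym in ji *.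
by case: (j \in M); rewrite ?(negbTE iM) ?finset.in_set1 ?(negbTE ji) mulr0.
Qed.

Lemma unchained_mean_lt f h x i j : valid_in_round f S h x ->
  i \in top_chain S h x -> j \notin top_chain S h x -> f j (x j) < f i (x i).
Proof.
rewrite !inE => fv iX jX.
have /andP[_ fj] := fv j; have /andP[fi _] := fv i.
apply: le_lt_trans fj (lt_le_trans _ fi).
apply: unchained_below iX jX; first exact: (lo_le_up SP).
have := est_le_lead h x j; rewrite !(est_midpoint SP); lra.
Qed.

Lemma valid_fair f h x : valid_in_round f S h x -> fair_in_round f S h x.
Proof.
move=> fv j j'; rewrite !sel_probE /uniform_on.
case: ifPn => j'X; case: ifPn => jX; rewrite ?ltxx //.
  by rewrite ltNge invr_ge0 ler0n.
by move=> _; exact: unchained_mean_lt fv jX j'X.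
Qed.

Lemma payment_ge0 h x j i : 0 <= payment S h x j i.
Proof.
by rewrite /payment /offer; case: ifP => // _; rewrite subr_ge0 est_le_lead.
Qed.

Lemma top_width_ge0 h x : 0 <= top_width S h x.
Proof. exact: max_width_ge0. Qed.

Lemma payment_le h x j i :
  i \in top_chain S h x -> payment S h x j i <= k%:R * top_width S h x.
Proof.
rewrite inE /payment /offer => iX; case: eqP => [<-|_]; last first.
  by rewrite mulr_ge0 ?top_width_ge0.
apply: le_trans (chained_spread _ _ _ (lead S h x) i (lo_le_up SP h x) _ iX).
  rewrite !(est_midpoint SP).
  by have := lo_le_up SP h x i; have := lo_le_up SP h x (lead S h x); lra.
exact: connect0.
Qed.

Lemma round_regret_le f h x i :
  valid_in_round f S h x -> i \in top_chain S h x -> (forall j, 0 <= f j (x j)) ->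
  \big[Num.max/0]_(j < k) f j (x j) <= f i (x i) + k%:R * top_width S h x.
Proof.
move=> fv iX f0; apply/bigmax_leP; split=> [|j _].
  by rewrite addr_ge0 // mulr_ge0 ?top_width_ge0.
case: (boolP (j \in top_chain S h x)) => jX; last first.
  rewrite -[leLHS]addr0 lerD ?mulr_ge0 ?top_width_ge0 //.
  by apply: ltW; exact: unchained_mean_lt fv iX jX.
move: (iX) (jX); rewrite !inE => iX' jX'.
have := chained_spread _ _ _ j i (lo_le_up SP h x) jX' iX'.
rewrite /top_width /top_chain.
by have /andP[_] := fv j; have /andP[] := fv i; lra.
Qed.

End FairPayments.

Section Measurability.
Local Open Scope classical_set_scope.

(* The pieces may overlap, so a maximizer need not be selected measurably. *)
Lemma measurable_fun_fin_cover {d d'} {T : measurableType d}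
    {U : measurableType d'} {I : finType} (D : I -> set T) (G : I -> T -> U)
    (F : T -> U) :
  (forall i, measurable (D i)) -> (forall i, measurable_fun setT (G i)) ->
  (forall w, exists i, D i w) -> (forall i w, D i w -> F w = G i w) ->
  measurable_fun setT F.
Proof.
move=> mD mG cov FG _ B mB.
have -> : setT `&` F @^-1` B = \bigcup_(i in setT) (D i `&` (setT `&` G i @^-1` B)).
  apply/seteqP; split=> [w [_ Bw]|w [i _ [Dw [_ Bw]]]].
    have [i Dw] := cov w; exists i => //; split=> //; split=> //.
    by rewrite /= -(FG i).
  by split=> //; rewrite /= (FG i).
apply: fin_bigcup_measurable; first exact: finite_finset.
by move=> i _; apply: measurableI => //; exact: mG.
Qed.

Lemma measurable_bigmax {d} {T : measurableType d} {R : realType} {I : Type}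
    (s : seq I) (Q : pred I) (g : I -> T -> R) :
  (forall i, measurable_fun setT (g i)) ->
  measurable_fun setT (fun w => \big[Num.max/0]_(i <- s | Q i) g i w).
Proof.
move=> mg; elim: s => [|a s IHs].
  by under eq_fun do rewrite big_nil; exact: measurable_cst.
under eq_fun do rewrite big_cons.
by case: (Q a) => //; exact: measurable_maxr.
Qed.

Lemma measurable_bool_set {d} {T : measurableType d} (b : T -> bool) :
  measurable_fun setT b -> measurable [set w | b w].
Proof. by move=> mb; rewrite -[X in measurable X]setTI; exact: (mb _ [set true]). Qed.

Lemma measurable_forall {d} {T : measurableType d} {I : finType}
    (b : I -> T -> bool) : (forall i, measurable_fun setT (b i)) ->
  measurable [set w | forall i, b i w].
Proof.
move=> mb; have -> : [set w | forall i, b i w] = \bigcap_(i in setT) [set w | b i w].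
  by apply/seteqP; split=> [w bw i _|w bw i]; apply: bw.
apply: fin_bigcap_measurable; first exact: finite_finset.
by move=> i _; exact: measurable_bool_set.
Qed.

Lemma measurable_eqb {d} {T : measurableType d} (b : T -> bool) (c : bool) :
  measurable_fun setT b -> measurable_fun setT (fun w => b w == c).
Proof.
move=> mb; case: c.
  by under eq_fun do rewrite eqb_id.
by under eq_fun do rewrite eqbF_neg; exact: measurableT_comp.
Qed.

Lemma measurable_chained {d} {T : measurableType d} {R : realType} {k : nat}
    (l u : T -> 'I_k -> R) (a b : 'I_k) : (forall w i, l w i <= u w i) ->
  (forall i, measurable_fun setT (l ^~ i)) ->
  (forall i, measurable_fun setT (u ^~ i)) ->
  measurable_fun setT (fun w => chained (l w) (u w) a b).
Proof.
move=> lu ml mu.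
have mlink i j : measurable_fun setT (fun w => linked (l w) (u w) i j).
  under eq_fun do rewrite linkedE //.
  by apply: measurable_and; exact: measurable_fun_ler.
apply: (@measurable_fun_fin_cover _ _ _ _ {ffun 'I_k * 'I_k -> bool}
  (fun e => [set w | forall p, linked (l w) (u w) p.1 p.2 == e p])
  (fun e _ => connect (fun i j => e (i, j)) a b)).
- by move=> e; apply: measurable_forall => p; exact: measurable_eqb.
- by move=> e; exact: measurable_cst.
- by move=> w; exists [ffun p => linked (l w) (u w) p.1 p.2] => p; rewrite ffunE.
- move=> e w /= ew; apply: eq_connect => i j; exact: (eqP (ew (i, j))).
Qed.

Section Round.
Context {R : realType} {k : nat} {X : Type} (S : scheme R k X).
Hypothesis SP : fair_payments S.
Context {d : measure_display} {T : measurableType d}.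
Variables (h : T -> seq (obs R k X)) (x : T -> profile k X).
Hypothesis mlo : forall i, measurable_fun setT (fun w => lo S (h w) (x w) i).
Hypothesis mup : forall i, measurable_fun setT (fun w => up S (h w) (x w) i).

Lemma measurable_est i : measurable_fun setT (fun w => est S (h w) (x w) i).
Proof.
under eq_fun do rewrite (est_midpoint SP).
by apply: measurable_funM => //; exact: measurable_funD.
Qed.

Lemma measurable_argmax m :
  measurable [set w | m \in argmax (est S (h w) (x w))].
Proof.
have -> : [set w | m \in argmax (est S (h w) (x w))] =
    [set w | forall j, est S (h w) (x w) j <= est S (h w) (x w) m].
  by apply/seteqP; split=> w /=; rewrite inE => /forallP.
by apply: measurable_forall => j; apply: measurable_fun_ler; exact: measurable_est.
Qed.

Lemma measurable_top_chain j :
  measurable_fun setT (fun w => j \in top_chain S (h w) (x w)).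
Proof.
apply: (measurable_fun_fin_cover
  (fun m => [set w | m \in argmax (est S (h w) (x w))])
  (fun m w => chained (lo S (h w) (x w)) (up S (h w) (x w)) m j)).
- exact: measurable_argmax.
- by move=> m; apply: measurable_chained => // w i; exact: (lo_le_up SP).
- by move=> w; exists (lead S (h w) (x w)); exact: (lead_argmax SP).
move=> m w mM; have lM := lead_argmax SP (h w) (x w).
rewrite /top_chain (chained_set_eq _ _ _ m) ?inE //.
exact: (argmax_chained S SP).
Qed.

Lemma measurable_top_width :
  measurable_fun setT (fun w => top_width S (h w) (x w)).
Proof.
apply: (@measurable_fun_fin_cover _ _ _ _ {set 'I_k}
  (fun A => [set w | forall j, (j \in top_chain S (h w) (x w)) == (j \in A)])
  (fun A w => max_width (lo S (h w) (x w)) (up S (h w) (x w)) A)).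
- by move=> A; apply: measurable_forall => j; apply: measurable_eqb;
    exact: measurable_top_chain.
- by move=> A; apply: measurable_bigmax => i; exact: measurable_funB.
- by move=> w; exists (top_chain S (h w) (x w)) => j.
- by move=> A w Aw; rewrite /top_width; congr max_width; apply/setP => j;
    exact/eqP.
Qed.

Lemma measurable_payment (a b : T -> 'I_k) :
  (forall i, measurable [set w | a w = i]) ->
  (forall i, measurable [set w | b w = i]) ->
  measurable_fun setT (fun w => payment S (h w) (x w) (a w) (b w)).
Proof.
move=> ma mb; apply: (@measurable_fun_fin_cover _ _ _ _ ('I_k * ('I_k * 'I_k))%type
  (fun c => [set w | c.1 \in argmax (est S (h w) (x w))] `&`
    ([set w | a w = c.2.1] `&` [set w | b w = c.2.2]))
  (fun c w => if c.2.2 == c.2.1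
    then est S (h w) (x w) c.1 - est S (h w) (x w) c.2.1 else 0)).
- move=> c; apply: measurableI; first exact: measurable_argmax.
  exact: measurableI.
- move=> c; case: (c.2.2 == c.2.1); last exact: measurable_cst.
  by apply: measurable_funB; exact: measurable_est.
- move=> w; exists (lead S (h w) (x w), (a w, b w)); split=> //.
  exact: (lead_argmax SP).
move=> c w [cM [/= <- <-]]; rewrite /payment /offer; case: ifP => // _.
congr (_ - _); apply: le_anti; rewrite (est_le_lead S SP) andbT.
by move: cM; rewrite /= inE => /forallP.
Qed.

End Round.
End Measurability.

Section Run.
Context {R : realType} {k T : nat} {dX : measure_display}
  {X : measurableType dX} {d : measure_display} {Omega : measurableType d}.
Context (P : probability Omega R) (f : 'I_k -> X -> R) (S : scheme R k X)
  (r : run R k dX X d Omega).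
Hypothesis SP : fair_payments S.
Hypothesis rP : is_run P T f S r.
Local Open Scope classical_set_scope.

Let top t w := top_chain S (hist r t w) (ctx r t w).

Lemma info_sub_measurable t : (t < T)%N -> info r t `<=` measurable.
Proof.
move=> tT; apply: smallest_sub; first exact: sigma_algebra_measurable.
move=> A [[s [j [B [st mB ->]]]]|[[s [i [st ->]]]|[s [B [st mB ->]]]]].
- have := ctx_measurable rP j (leq_ltn_trans st tT) measurableT mB.
  by rewrite setTI.
- exact: (arm_measurable rP i (ltn_trans st tT)).
- have := reward_measurable rP (ltn_trans st tT) measurableT mB.
  by rewrite setTI.
Qed.

Lemma info_measurable_fun t (g : Omega -> R) : info_measurable r t g ->
  measurable_fun setT (g : g_sigma_algebraType (info_gen r t) -> R).
Proof. by move=> mg _ B mB; rewrite setTI; exact: mg. Qed.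

Lemma info_measurable_measurable t (g : Omega -> R) : (t < T)%N ->
  info_measurable r t g -> measurable_fun setT g.
Proof.
by move=> tT mg _ B mB; rewrite setTI; apply: (info_sub_measurable t tT); exact: mg.
Qed.

Lemma info_outside t i : (t < T)%N -> info r t [set w | i \notin top t w].
Proof.
move=> tT; apply: (@measurable_bool_set _ (g_sigma_algebraType (info_gen r t))).
apply: measurableT_comp => //.
apply: (@measurable_top_chain _ _ _ S SP _ (g_sigma_algebraType (info_gen r t))) => a;
  apply: info_measurable_fun.
  exact: (lo_measurable rP).
exact: (up_measurable rP).
Qed.

(* The selection law only says that the agent stays in the top chained set
   almost surely: tested on the event that arm i is outside it, which is known
   when the payments are offered, it gives probability zero. *)
Lemma arm_top_chain : {ae P, forall w, forall t : 'I_T, arm r t w \in top t w}.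
Proof.
apply: filter_forall => t; have tT := ltn_ord t.
have null (p : 'I_k * 'I_k) :
    {ae P, forall w, ~ (p.2 \notin top t w /\ target r t w = p.1 /\ arm r t w = p.2)}.
  have iA := info_outside t p.2 tT.
  exists ([set w | p.2 \notin top t w] `&` [set w | target r t w = p.1] `&`
    [set w | arm r t w = p.2]); split.
  - apply: measurableI; last exact: (arm_measurable rP).
    apply: measurableI; first exact: (info_sub_measurable t tT).
    exact: (target_measurable rP).
  - rewrite (selection_law rP) //; apply: integral0_eq => w pX.
    by rewrite (round_law_outside S SP).
  - by move=> w /= /contrapT [? []].
apply: filterS (filter_forall _ null) => w out.
by apply/negPn/negP => aX; apply: (out (target r t w, arm r t w)).
Qed.

Let mlo t i (tT : (t < T)%N) :=
  info_measurable_measurable t _ tT (lo_measurable rP i tT).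
Let mup t i (tT : (t < T)%N) :=
  info_measurable_measurable t _ tT (up_measurable rP i tT).

Lemma measurable_cost : measurable_fun setT (cost T S r).
Proof.
apply: measurable_sum => t; have tT := ltn_ord t.
apply: (measurable_payment S SP) => i; [exact: mlo|exact: mup| |].
- exact: (target_measurable rP).
- exact: (arm_measurable rP).
Qed.

Lemma measurable_total_width : measurable_fun setT (total_width T S r).
Proof.
apply: measurable_sum => t; have tT := ltn_ord t.
by apply: (measurable_top_width S SP) => i; [exact: mlo|exact: mup].
Qed.

Lemma total_width_ge0 w : 0 <= total_width T S r w.
Proof. by apply: sumr_ge0 => t _; exact: top_width_ge0. Qed.

Lemma cost_ge0 w : 0 <= cost T S r w.
Proof. by apply: sumr_ge0 => t _; exact: payment_ge0. Qed.

Lemma cost_le : {ae P, forall w, cost T S r w <= k%:R * total_width T S r w}.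
Proof.
apply: filterS arm_top_chain => w aX.
by rewrite /cost /total_width mulr_sumr; apply: ler_sum => t _; exact: payment_le.
Qed.

Lemma expectation_total_widthZ :
  (\int[P]_w (k%:R * total_width T S r w)%:E =
   k%:R%:E * 'E_P[total_width T S r])%E.
Proof.
rewrite unlock; under eq_integral do rewrite EFinM.
rewrite ge0_integralZl_EFin ?ler0n //.
- by move=> w _; rewrite lee_fin total_width_ge0.
- by apply/measurable_EFinP; exact: measurable_total_width.
Qed.

Lemma expectation_cost_le :
  ('E_P[cost T S r] <= k%:R%:E * 'E_P[total_width T S r])%E.
Proof.
rewrite -expectation_total_widthZ unlock; apply: ae_ge0_le_integral => //.
- by move=> w _; rewrite lee_fin cost_ge0.
- by apply/measurable_EFinP; exact: measurable_cost.
- by move=> w _; rewrite lee_fin mulr_ge0 ?total_width_ge0.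
- apply/measurable_EFinP; apply: measurable_funM => //.
  exact: measurable_total_width.
- by apply: filterS cost_le => w wle _; rewrite lee_fin.
Qed.

Section Regret.
Hypothesis mf : forall j, measurable_fun [set: X] (f j).
Hypothesis f01 : forall j y, 0 <= f j y <= 1.

Let f0 j y : 0 <= f j y. Proof. by case/andP: (f01 j y). Qed.
Let f1 j y : f j y <= 1. Proof. by case/andP: (f01 j y). Qed.

Lemma measurable_mean t j : (t < T)%N ->
  measurable_fun setT (fun w => f j (ctx r t w j)).
Proof.
by move=> tT; apply: measurableT_comp => //; exact: (ctx_measurable rP).
Qed.

Lemma measurable_best_mean : measurable_fun setT (best_mean T f r).
Proof.
by apply: measurable_sum => t; apply: measurable_bigmax => j; exact: measurable_mean.
Qed.

Lemma measurable_earned_mean : measurable_fun setT (earned_mean T f r).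
Proof.
apply: measurable_sum => t; have tT := ltn_ord t.
apply: (measurable_fun_fin_cover (fun i => [set w | arm r t w = i])
  (fun i w => f i (ctx r t w i))).
- by move=> i; exact: (arm_measurable rP).
- by move=> i; exact: measurable_mean.
- by move=> w; exists (arm r t w).
- by move=> i w <-.
Qed.

Lemma best_mean_ge0 w : 0 <= best_mean T f r w.
Proof. by apply: sumr_ge0 => t _; exact: bigmax_ge_id. Qed.

Lemma earned_mean_ge0 w : 0 <= earned_mean T f r w.
Proof. by apply: sumr_ge0 => t _. Qed.

Lemma sum_le_rounds (g : 'I_T -> R) : (forall t, g t <= 1) -> \sum_t g t <= T%:R.
Proof.
move=> g1; apply: le_trans (ler_sum _ (fun t _ => g1 t)) _.
by rewrite sumr_const card_ord.
Qed.

Lemma best_mean_le w : best_mean T f r w <= T%:R.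
Proof. by apply: sum_le_rounds => t; apply/bigmax_leP; split=> [|j _]. Qed.

Lemma expectation_earned_mean_fin : ('E_P[earned_mean T f r])%E \is a fin_num.
Proof.
rewrite unlock ge0_fin_numE; last first.
  by apply: integral_ge0 => w _; rewrite lee_fin earned_mean_ge0.
apply: (@le_lt_trans _ _ (\int[P]_w (T%:R%:E : \bar R))%E).
  apply: ge0_le_integral => //.
  - by move=> w _; rewrite lee_fin earned_mean_ge0.
  - by apply/measurable_EFinP; exact: measurable_earned_mean.
  - by move=> w _; rewrite lee_fin sum_le_rounds.
by rewrite integral_cst // lte_mul_pinfty ?lee_fin // ltey_eq fin_num_measure.
Qed.

Lemma best_mean_le_valid E :
  (forall w, E w -> forall t, (t < T)%N ->
     valid_in_round f S (hist r t w) (ctx r t w)) ->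
  {ae P, forall w, best_mean T f r w <=
    earned_mean T f r w + (k%:R * total_width T S r w + T%:R * \1_(~` E) w)}.
Proof.
move=> Ev; apply: filterS arm_top_chain => w aX.
have kW : 0 <= k%:R * total_width T S r w by rewrite mulr_ge0 ?total_width_ge0.
have [Ew|Ew] := pselect (E w); last first.
  rewrite indicE mem_set // mulr1 addrA -[leLHS]add0r lerD ?best_mean_le //.
  by rewrite addr_ge0 // earned_mean_ge0.
rewrite indicE memNset // mulr0 addr0 mulr_sumr -big_split /=.
by apply: ler_sum => t _; apply: round_regret_le => //; exact: Ev.
Qed.

Lemma regret_le (E : set Omega) (delta : R) :
  measurable E -> ((1 - delta)%:E <= P E)%E ->
  (forall w, E w -> forall t, (t < T)%N ->
     valid_in_round f S (hist r t w) (ctx r t w)) ->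
  (regret P T f r <=
    k%:R%:E * 'E_P[total_width T S r] + (delta * T%:R)%:E)%E.
Proof.
move=> mE PE Ev; have mCE := measurableC mE.
have mW : measurable_fun setT (fun w => k%:R * total_width T S r w).
  by apply: measurable_funM => //; exact: measurable_total_width.
have mI : measurable_fun setT (fun w => T%:R * \1_(~` E) w : R).
  by apply: measurable_funM => //; exact: measurable_indic.
have kW0 w : 0 <= k%:R * total_width T S r w by rewrite mulr_ge0 ?total_width_ge0.
have I0 w : 0 <= T%:R * \1_(~` E) w :> R by rewrite mulr_ge0.
have PCE : (P (~` E) <= delta%:E)%E.
  rewrite probability_setC // leeBlDr ?fin_num_measure //.
  by rewrite addeC -leeBlDr // -EFinB.
rewrite /regret leeBlDr ?expectation_earned_mean_fin //.
apply: (@le_trans _ _ (\int[P]_w (earned_mean T f r w +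
    (k%:R * total_width T S r w + T%:R * \1_(~` E) w))%:E)%E).
  rewrite unlock; apply: ae_ge0_le_integral => //.
  - by move=> w _; rewrite lee_fin best_mean_ge0.
  - by apply/measurable_EFinP; exact: measurable_best_mean.
  - by move=> w _; rewrite lee_fin !addr_ge0 ?earned_mean_ge0.
  - apply/measurable_EFinP; apply: measurable_funD; first exact: measurable_earned_mean.
    exact: measurable_funD.
  - by apply: filterS (best_mean_le_valid E Ev) => w wle _; rewrite lee_fin.
under eq_integral do rewrite !EFinD.
rewrite ge0_integralD //=; first last.
- by apply/measurable_EFinP; exact: measurable_funD.
- by move=> w _; rewrite -EFinD lee_fin addr_ge0.
- by apply/measurable_EFinP; exact: measurable_earned_mean.
- by move=> w _; rewrite lee_fin earned_mean_ge0.
rewrite ge0_integralD //=; first last.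
- exact/measurable_EFinP.
- exact/measurable_EFinP.
- by move=> w _; rewrite lee_fin.
rewrite expectation_total_widthZ unlock addeC leeD2r //.
rewrite leeD2l //; under eq_integral do rewrite EFinM.
rewrite ge0_integralZl_EFin //; last first.
  by apply/measurable_EFinP; exact: measurable_indic.
by rewrite integral_indic // setIT mulrC EFinM lee_wpmul2l // lee_fin.
Qed.

End Regret.
End Run.

Theorem theorem6p1 (R : realType) :
  exists2 C : R, 0 < C &
  forall (k T : nat) (delta : R)
    (dX : measure_display) (X : measurableType dX)
    (f : 'I_k -> X -> R) (S : scheme R k X)
    (d : measure_display) (Omega : measurableType d) (P : probability Omega R)
    (r : run R k dX X d Omega),
  0 < delta < 1 ->
  (forall j, measurable_fun [set: X]%classic (f j)) ->
  (forall j x, 0 <= f j x <= 1) ->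
  fair_payments S ->
  is_run P T f S r ->
  with_prob_at_least P (1 - delta)
    [set w | forall t, (t < T)%N ->
       valid_in_round f S (hist r t w) (ctx r t w)]%classic ->
  [/\ with_prob_at_least P (1 - delta)
        [set w | forall t, (t < T)%N ->
           fair_in_round f S (hist r t w) (ctx r t w)]%classic,
      with_prob_at_least P (1 - delta)
        [set w | forall t, (t < T)%N ->
           forall x, valid_in_round f S (hist r t w) x]%classic ->
      with_prob_at_least P (1 - delta)
        [set w | forall t, (t < T)%N ->
           forall x, fair_in_round f S (hist r t w) x]%classic,
      ('E_P[cost T S r] <=
         C%:E * (k%:R%:E * 'E_P[total_width T S r] + (delta * T%:R)%:E))%E &
      (regret P T f r <=
         C%:E * (k%:R%:E * 'E_P[total_width T S r] + (delta * T%:R)%:E))%E ].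
Proof.
exists 1 => // k T delta dX X f S d Omega P r /andP[delta0 _] mf f01 SP rP.
move=> [E [mE PE Ev]]; rewrite mul1e; split.
- exists E; split=> // w /Ev wv t tT; exact: valid_fair (wv t tT).
- move=> [E' [mE' PE' Ev']]; exists E'; split=> // w /Ev' wv t tT x.
  exact: valid_fair (wv t tT x).
- apply: le_trans (expectation_cost_le P f S r SP rP) _.
  by rewrite leeDl // lee_fin mulr_ge0 // ltW.
- exact: regret_le mE PE Ev.
Qed.
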